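(* Let $R>0$, let $w$ be a pseudo-definite weight function on the disc $D_R$, let $N\ge1$ be an integer, and for each index $(k,\ell)$ with $w_{(k,\ell)}\not\equiv0$ let $\kappa_{N,(k,\ell)}$ be the leading coefficient of the $N$-th degree orthonormal polynomial $Q_{N,(k,\ell)}$ with respect to the measure $\rho^{k/2}|w_{(k,\ell)}(\sqrt\rho)|\,d\rho$ on the interval $[0,R^2]$. Then for every function $f\in C^{2N}(\overline{D_R})$ and every such index $(k,\ell)$, $$I_{(k,\ell)}:=\left|\int_0^{R^2}f_{(k,\ell)}(\sqrt\rho)\,w_{(k,\ell)}(\sqrt\rho)\,d\rho-\sum_{j=1}^{N}f_{(k,\ell)}\!\left(\sqrt{t_{j,(k,\ell)}}\right)t_{j,(k,\ell)}^{-k/2}\lambda_{j,(k,\ell)}\right|\le\frac{1}{(2N)!\,\kappa_{N,(k,\ell)}^2}\left\|\frac{d^{2N}}{d\rho^{2N}}g_{(k,\ell)}(\rho)\right\|_\infty,$$ where $g_{(k,\ell)}(\rho):=\rho^{-k/2}f_{(k,\ell)}(\sqrt\rho)$ and $\|\cdot\|_\infty$ is the supremum over $(0,R^2)$ (possibly $+\infty$). Moreover, for every integer $K\ge0$, the difference $$\left|\frac12\sum_{k=0}^{K}\sum_{\ell=1}^{a_k}\int_0^{R^2}f_{(k,\ell)}(\sqrt\rho)\,w_{(k,\ell)}(\sqrt\rho)\,d\rho-\frac12\sum_{k=0}^{K}\sum_{\ell=1}^{a_k}\sum_{j=1}^{N}f_{(k,\ell)}\!\left(\sqrt{t_{j,(k,\ell)}}\right)t_{j,(k,\ell)}^{-k/2}\lambda_{j,(k,\ell)}\right|$$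 is bounded by $$\sum_{k=0}^{K}\sum_{\ell=1}^{a_k}I_{(k,\ell)}\le\frac{1}{(2N)!}\sum_{k=0}^{K}\sum_{\ell=1}^{a_k}\frac{1}{\kappa_{N,(k,\ell)}^2}\left\|\frac{d^{2N}}{d\rho^{2N}}g_{(k,\ell)}(\rho)\right\|_\infty ,$$ where terms with $w_{(k,\ell)}\equiv0$ are omitted from the sums (they contribute $0$).
   Context: Points of the plane are written $re^{i\varphi}=(r\cos\varphi,r\sin\varphi)$; $D_R=\{x^2+y^2<R^2\}$. Put $a_0=1$, $a_k=2$ for $k\ge1$, $Y_{(0,1)}(\varphi)=1/\sqrt{2\pi}$, and for $k\ge1$: $Y_{(k,1)}(\varphi)=\frac1{\sqrt\pi}\cos k\varphi$, $Y_{(k,2)}(\varphi)=\frac1{\sqrt\pi}\sin k\varphi$. The Fourier coefficients of a function $f$ are $f_{(k,\ell)}(r)=\int_0^{2\pi}f(re^{i\varphi})Y_{(k,\ell)}(\varphi)\,d\varphi$, and similarly $w_{(k,\ell)}(r)$ for $w$, $0<r<R$. The weight $w$ is a real-valued function on $D_R$ (not necessarily non-negative), continuous except possibly at $0$. It is called pseudo-definite if for each $(k,\ell)$ either $w_{(k,\ell)}(r)\ge0$ for all $r\in(0,R)$ or $w_{(k,\ell)}(r)\le0$ for all $r\in(0,R)$. Standing assumption: each $w_{(k,\ell)}$ is continuous on $(0,R)$ and $\int_0^R|w_{(k,\ell)}(r)|\,r\,dr<\infty$. For each $(k,\ell)$ with $w_{(k,\ell)}\not\equiv0$, the numbers $t_{1,(k,\ell)}<\dots<t_{N,(k,\ell)}$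 in $(0,R^2)$ and $\lambda_{1,(k,\ell)},\dots,\lambda_{N,(k,\ell)}$ (all of the same sign) are the nodes and weights of the $N$-point Gauss quadrature for $\rho^{k/2}w_{(k,\ell)}(\sqrt\rho)\,d\rho$ on $[0,R^2]$, i.e. $$\sum_{j=1}^N\lambda_{j,(k,\ell)}t_{j,(k,\ell)}^{s}=\int_0^{R^2}\rho^s\,\rho^{k/2}w_{(k,\ell)}(\sqrt\rho)\,d\rho\qquad(0\le s\le 2N-1).$$ *)

(* Defs.v *)
From HB Require Import structures.
From mathcomp Require Import all_boot all_order all_algebra.
From mathcomp Require Import all_classical all_reals all_analysis.

Set Implicit Arguments.
Unset Strict Implicit.
Unset Printing Implicit Defensive.

Import Order.TTheory GRing.Theory Num.Theory.
Import numFieldNormedType.Exports.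

Local Open Scope classical_set_scope.
Local Open Scope ring_scope.

(* Integrals are Lebesgue integrals, taken over open intervals whenever the
   integrand involves functions on the open disc: their values at radius [rad]
   carry no meaning, and the end points are a null set. *)

Section Definitions.
Context {R : realType}.
Implicit Types (rad : R) (f w : R * R -> R) (v : R -> R) (k l : nat).

Definition disc rad : set (R * R) :=
  [set p | p.1 ^+ 2 + p.2 ^+ 2 < rad ^+ 2].

(* C^n of the closure of an open set [U]: all partial derivatives of order at
   most n exist in [U] and extend continuously to [closure U]. *)
Fixpoint Cn_closure (n : nat) (U : set (R * R)) f : Prop :=
  {within closure U, continuous f} /\
  if n is m.+1 then
    forall e : R * R, e = (1, 0) \/ e = (0, 1) ->
      (forall p, U p -> derivable f p e) /\
      exists2 h : R * R -> R,
        forall p, U p -> h p = 'D_e f p & Cn_closure m U h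
  else True.

(* For a fixed k, the index l ranges over 1, ..., a k. *)
Definition a k : nat := if k == 0%N then 1%N else 2%N.

Definition is_index k l : bool := (1 <= l <= a k)%N.

Definition Y k l (phi : R) : R :=
  if k == 0%N then (Num.sqrt (2 * pi))^-1
  else if l == 1%N then (Num.sqrt pi)^-1 * cos (k%:R * phi)
  else (Num.sqrt pi)^-1 * sin (k%:R * phi).

Definition fourier f k l (r : R) : R :=
  \int[lebesgue_measure]_(phi in `[0, 2 * pi])
    (f (r * cos phi, r * sin phi) * Y k l phi).

Definition is_weight rad w : Prop :=
  [/\ {within disc rad `\ (0, 0), continuous w},
      forall k l, is_index k l -> {in `]0, rad[, continuous (fourier w k l)}
    & forall k l, is_index k l ->
        (\int[lebesgue_measure]_(r in `]0%R, rad[)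
           (`|fourier w k l r| * r)%:E < +oo)%E].

Definition pseudo_definite rad w : Prop :=
  forall k l, is_index k l ->
    (forall r, 0 < r < rad -> 0 <= fourier w k l r) \/
    (forall r, 0 < r < rad -> fourier w k l r <= 0).

Definition fourier_neq0 rad w k l : Prop :=
  exists2 r, 0 < r < rad & fourier w k l r != 0.

Definition radial_density w k l (rho : R) : R :=
  rho `^ (k%:R / 2) * fourier w k l (Num.sqrt rho).

Definition radial_abs_density w k l (rho : R) : R :=
  rho `^ (k%:R / 2) * `|fourier w k l (Num.sqrt rho)|.

(* [t] and [lam] are the nodes and weights of the N-point Gauss quadrature for
   the (possibly negative) measure [v rho d rho] on the interval [0, b]. *)
Definition is_gauss_quadrature (b : R) v (N : nat) (t lam : 'I_N -> R) : Prop :=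
  [/\ forall i j : 'I_N, (i < j)%N -> t i < t j,
      forall j, 0 < t j < b,
      (forall j, 0 < lam j) \/ (forall j, lam j < 0)
    & forall s : nat, (s <= 2 * N - 1)%N ->
        \sum_(j < N) lam j * t j ^+ s =
        \int[lebesgue_measure]_(rho in `]0, b[) (rho ^+ s * v rho)].

Definition is_orthonormal_polys (b : R) v (Q : nat -> {poly R}) : Prop :=
  [/\ forall n, size (Q n) = n.+1,
      forall n, 0 < lead_coef (Q n)
    & forall m n,
        \int[lebesgue_measure]_(rho in `]0, b[)
          ((Q m).[rho] * (Q n).[rho] * v rho) = (m == n)%:R].

(* Supremum over ]0, b[ of the absolute value, in the extended reals. *)
Definition sup_norm (b : R) (h : R -> R) : \bar R :=
  ereal_sup [set `|h rho|%:E | rho in `]0, b[].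

Definition g_fun f k l (rho : R) : R :=
  rho `^ (- (k%:R / 2)) * fourier f k l (Num.sqrt rho).

Definition radial_integral rad f w k l : R :=
  \int[lebesgue_measure]_(rho in `]0, rad ^+ 2[)
    (fourier f k l (Num.sqrt rho) * fourier w k l (Num.sqrt rho)).

Definition radial_quadrature f k l (N : nat) (t lam : 'I_N -> R) : R :=
  \sum_(j < N)
    fourier f k l (Num.sqrt (t j)) * t j `^ (- (k%:R / 2)) * lam j.

Definition quadrature_error rad f w k l (N : nat) (t lam : 'I_N -> R) : R :=
  `|radial_integral rad f w k l - radial_quadrature f k l t lam|.

End Definitions.

(* Main.v *)
(* On ]0, R^2[ the function g is 2N times differentiable: functions of the form
   rho^c * int h(sqrt rho e^{i phi}) k(phi) dphi, with h in C^n, have as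
   derivatives sums of functions of the same form with h in C^(n-1).  Let H be
   the Hermite interpolant of g of degree < 2N with double nodes at the t_j, and
   P the product of the X - t_j.  By Rolle, g - H = g^(2N)(xi) / (2N)! * P^2
   pointwise, and the quadrature integrates H exactly, so the error is at most
   ||g^(2N)|| / (2N)! times the integral of P^2 against the absolute density.
   Exactness up to degree 2N - 1 makes P orthogonal to all lower degrees, hence
   P = Q_N / kappa and that integral is 1 / kappa^2. *)
Require Import Defs.
From HB Require Import structures.
From mathcomp Require Import all_boot all_order all_algebra.
From mathcomp Require Import all_classical all_reals all_analysis.
From mathcomp Require Import measurable_realfun ring lra.

Set Implicit Arguments.
Unset Strict Implicit.
Unset Printing Implicit Defensive.

Import Order.TTheory GRing.Theory Num.Theory.
Import numFieldNormedType.Exports.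

Local Open Scope classical_set_scope.
Local Open Scope ring_scope.

(** * Rolle's theorem and Hermite interpolation *)

(** [derive1n] is a total function, so the existence of the derivatives is recorded apart. The
    derivative of order [n] exists on the open interval but need not be continuous there. *)
Definition n_derivable {R : realType} (n : nat) (a b : R) (f : R -> R) : Prop :=
  forall m, (m < n)%N -> {in `]a, b[, forall x, derivable (derive1n m f) x 1}.

Section Rolle_Hermite.
Context {R : realType}.
Implicit Types (f g : R -> R) (a b x y : R) (s : seq R) (H p : {poly R}).

(** Rolle is applied in each gap between neighbours of the sorted list, so the new zeros interlace
    with the old ones. That they avoid the old ones is what allows double zeros to be counted
    later. *)
Lemma Rolle_path f a b x s :
  {in `]a, b[, forall y, derivable f y 1} ->
  path <%R x s -> {subset x :: s <= `]a, b[} -> {in x :: s, forall y, f y = 0} ->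
  exists s', [/\ path <%R x s', size s' = size s, {subset s' <= `]a, b[},
    {in s', forall y, derive1 f y = 0} & {in s', forall y, y \notin x :: s}].
Proof.
move=> df; elim: s x => [|y s IH] x /= => [_ _ _|/andP[xy ys] sab f0].
  by exists [::].
have [//|z zs||s' [ys' szs' s'ab f's' s's]] := IH y.
- by apply: sab; rewrite inE zs orbT.
- by move=> z zs; apply: f0; rewrite inE zs orbT.
have xab : x \in `]a, b[ by apply: sab; rewrite mem_head.
have yab : y \in `]a, b[ by apply: sab; rewrite !inE eqxx orbT.
have sub : {subset `[x, y] <= `]a, b[}.
  move=> z; move: xab yab; rewrite !in_itv /= => /andP[ax _] /andP[_ yb] /andP[xz zy].
  by rewrite (lt_le_trans ax)//= (le_lt_trans zy).
have [|||c cxy /@derive_val dfc] := @Rolle R f x y xy.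
- by move=> z /subset_itv_oo_cc/sub /df.
- by apply: derivable_within_continuous => z /sub /df.
- by rewrite !f0 ?inE ?eqxx ?orbT.
move: (cxy); rewrite in_itv /= => /andP[xc cy].
have ys'_lt : {in s', forall z, y < z}.
  by move=> z zs'; have /allP := order_path_min lt_trans ys'; exact.
have ys_lt : {in s, forall z, y < z}.
  by move=> z zs; have /allP := order_path_min lt_trans ys; exact.
exists (c :: s'); split => /=.
- rewrite xc /= path_min_sorted//; first exact: path_sorted ys'.
  by apply/allP => z /ys'_lt; exact: lt_trans.
- by rewrite szs'.
- by move=> z; rewrite inE => /orP[/eqP->|/s'ab//]; apply/sub/subset_itv_oo_cc.
- move=> z; rewrite inE => /orP[/eqP->|/f's'//].
  by rewrite derive1E dfc.
- move=> z; rewrite inE => /orP[/eqP->|zs'].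
    rewrite !inE (gt_eqF xc) (lt_eqF cy) /=.
    by apply/negP => /ys_lt; rewrite ltNge (ltW cy).
  rewrite inE negb_or s's// andbT.
  by rewrite gt_eqF// (lt_trans xy)// ys'_lt.
Qed.

Lemma Rolle_uniq f a b s :
  {in `]a, b[, forall y, derivable f y 1} ->
  uniq s -> {subset s <= `]a, b[} -> {in s, forall y, f y = 0} ->
  exists s', [/\ uniq s', size s' = (size s).-1, {subset s' <= `]a, b[},
    {in s', forall y, derive1 f y = 0} & {in s', forall y, y \notin s}].
Proof.
move=> df us sab f0.
have := sort_lt_sorted s; rewrite us.
have ms := mem_sort <=%R s; have := size_sort <=%R s.
case: (sort <=%R s) ms => [|x t] ms szt /= => [_|pxt].
  by exists [::]; rewrite -szt.
have [y|y|s' [ps' ss' s'ab f's' s's]] := Rolle_path df pxt.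
- by rewrite ms; exact: sab.
- by rewrite ms; exact: f0.
exists s'; split => //.
- by rewrite lt_sorted_uniq//; exact: path_sorted ps'.
- by rewrite -szt ss'.
- by move=> y /s's; rewrite ms.
Qed.

(** Each differentiation costs one zero, so one is left after [n] steps. *)
Lemma Rolle_derive1n n f a b s :
  n_derivable n a b f -> size s = n.+1 ->
  uniq s -> {subset s <= `]a, b[} -> {in s, forall y, f y = 0} ->
  exists2 y, y \in `]a, b[ & derive1n n f y = 0.
Proof.
elim: n f s => [|n IH] f s df szs us sab f0.
  case: s szs us sab f0 => // x s _ _ sab f0.
  by exists x; [apply: sab|apply: f0]; rewrite mem_head.
have df0 : {in `]a, b[, forall y, derivable f y 1} by exact: (df 0).
have [s' [us' szs' s'ab f's' _]] := Rolle_uniq df0 us sab f0.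
have [||y yab fy] := IH (derive1 f) s' _ _ us' s'ab f's'.
- by move=> m mn x xab; rewrite -derive1Sn; exact: df.
- by rewrite szs' szs.
by exists y => //; rewrite derive1Sn.
Qed.

Lemma derive1n_horner p n : derive1n n (horner p) = horner p^`(n).
Proof.
elim: n => [|n IH]; first by rewrite derivn0.
by rewrite derivnS derive1nS IH; apply/funext => x; rewrite -derivE.
Qed.

Lemma n_derivable_horner p n a b : n_derivable n a b (horner p).
Proof. by move=> m _ x _; rewrite derive1n_horner; exact: derivable_horner. Qed.

(** The formula for the derivatives holds only inside the interval. Since the interval is open it
    holds near each of its points, which is enough to differentiate it once more. *)
Lemma n_derivableB n f g a b : n_derivable n a b f -> n_derivable n a b g ->
  n_derivable n a b (f \- g) /\
  forall m, (m <= n)%N -> {in `]a, b[, derive1n m (f \- g) =1 derive1n m f \- derive1n m g}.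
Proof.
move=> df dg.
have E m : (m <= n)%N -> {in `]a, b[, derive1n m (f \- g) =1 derive1n m f \- derive1n m g}.
  elim: m => [//|m IH mn] x xab.
  rewrite /= !derive1E.
  have -> : 'D_1 (derive1n m (f \- g)) x = 'D_1 (derive1n m f \- derive1n m g) x.
    apply: near_eq_derive.
    near=> y; apply: IH; first exact: ltnW.
    near: y; exact: near_in_itvoo.
  by rewrite deriveB//; [exact: (df m mn x xab)|exact: (dg m mn x xab)].
split => // m mn x xab.
have : derivable (derive1n m f \- derive1n m g) x 1.
  by apply: derivableB; [exact: (df m mn x xab)|exact: (dg m mn x xab)].
apply: near_eq_derivable.
near=> y; apply/esym/E; first exact: ltnW.
near: y; exact: near_in_itvoo.
Unshelve. all: by end_near. Qed.

(** Newton's scheme with double nodes: a new node [x] is served by adding [p * q], where [p]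
    vanishes to order two at the old nodes and the linear [q] has two free coefficients. *)
Lemma hermite_interpolation (g dg : R -> R) s : uniq s ->
  exists2 H : {poly R}, (size H <= 2 * size s)%N &
    {in s, forall x, H.[x] = g x /\ H^`().[x] = dg x}.
Proof.
elim: s => [_|x s IH /= /andP[xs /IH[H szH Hs]]].
  by exists 0; rewrite ?size_poly0.
have [p [szp px ps]] : exists p : {poly R}, [/\ size p = (2 * size s).+1,
    p.[x] != 0 & {in s, forall y, p.[y] = 0 /\ p^`().[y] = 0}].
  exists ((\prod_(y <- s) ('X - y%:P)) ^+ 2); split.
  - rewrite expr2 size_monicM ?monic_neq0 ?monic_prod_XsubC//.
    by rewrite size_prod_XsubC addnS /= addSn mul2n addnn.
  - rewrite horner_exp expf_neq0//.
    by move: xs; rewrite -root_prod_XsubC => /rootP/eqP.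
  - move=> y ys.
    have r : (\prod_(y <- s) ('X - y%:P)).[y] = 0 :> R.
      by apply/rootP; rewrite root_prod_XsubC.
    by rewrite expr2 derivM hornerD !hornerM r !(mulr0, mul0r) addr0.
(* [u] and [v] are the values of [q] and of its derivative at [x], solved from the two conditions on
   [H + p * q] there. *)
pose u := (g x - H.[x]) / p.[x].
pose v := (dg x - H^`().[x] - p^`().[x] * u) / p.[x].
pose q : {poly R} := u%:P + v *: ('X - x%:P).
exists (H + p * q).
  rewrite (leq_trans (size_polyD _ _))// geq_max; apply/andP; split.
    by rewrite (leq_trans szH)// leq_pmul2l.
  rewrite (leq_trans (size_polyMleq _ _))//.
  have szq : (size q <= 2)%N.
    rewrite (leq_trans (size_polyD _ _))// geq_max.
    rewrite (leq_trans (size_polyC_leq1 _))//=.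
    by rewrite (leq_trans (size_scale_leq _ _))// size_XsubC.
  by rewrite szp /= mulnS addnC leq_add2r.
move=> y; rewrite inE => /orP[/eqP->|ys].
  have qx : q.[x] = u by rewrite /q !hornerE subrr mulr0 addr0.
  have dq : q^`().[x] = v.
    by rewrite /q derivD derivC derivZ derivXsubC add0r !hornerE.
  rewrite derivD derivM !hornerD !hornerM qx dq /v /u.
  by split; field.
have [Hy dHy] := Hs y ys; have [p0 dp0] := ps y ys.
rewrite derivD derivM !hornerD !hornerM p0 dp0 Hy dHy.
by rewrite !mul0r !addr0.
Qed.

Lemma hermite_error g a b s H : (0 < size s)%N ->
  n_derivable (2 * size s) a b g -> uniq s -> {subset s <= `]a, b[} ->
  (size H <= 2 * size s)%N ->
  {in s, forall x, H.[x] = g x /\ H^`().[x] = derive1 g x} ->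
  {in `]a, b[, forall x, exists2 y, y \in `]a, b[ &
    g x - H.[x] =
    derive1n (2 * size s) g y / (2 * size s)`!%:R * (\prod_(z <- s) ('X - z%:P)).[x] ^+ 2}.
Proof.
set n := size s; set P := \prod_(z <- s) _ => n0 dg us sab szH Hs x xab.
(* At a node both sides vanish, so any point of the interval serves as [y], for instance [x]. *)
have [xs|xs] := boolP (x \in s).
  exists x => //; have [-> _] := Hs _ xs.
  by rewrite (_ : P.[x] = 0) ?expr0n ?mulr0 ?subrr//; apply/rootP; rewrite root_prod_XsubC.
have Px : P.[x] != 0 by move: xs; rewrite -root_prod_XsubC => /rootP/eqP.
(* [g - p] vanishes at [x] and, to order two, at the nodes: Rolle gives its
   derivative [2 * n] distinct zeros, the nodes and [n] points between them. *)
pose l := (g x - H.[x]) / P.[x] ^+ 2.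
pose p := H + l *: P ^+ 2.
have [dphi phiE] := n_derivableB dg (@n_derivable_horner p (2 * n) a b).
have Ps y : y \in s -> P.[y] = 0 by move=> ys; apply/rootP; rewrite root_prod_XsubC.
have n20 : (0 < 2 * n)%N by rewrite muln_gt0.
have [||||s' [us' szs' s'ab d0 s's]] := @Rolle_uniq (g \- horner p) a b (x :: s).
- by exact: (dphi 0).
- by rewrite /= xs.
- by move=> y; rewrite inE => /orP[/eqP->//|/sab].
- move=> y; rewrite inE /p => /orP[/eqP->|ys] /=;
      rewrite hornerD hornerZ horner_exp.
    by rewrite /l divfK ?expf_neq0//; ring.
  by rewrite (Hs _ ys).1 Ps// expr0n mulr0 addr0 subrr.
(* The [2 * n] zeros belong to the first derivative, so only [(2 * n).-1] differentiations
   remain. *)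
have [|||||y yab] := @Rolle_derive1n (2 * n).-1 (derive1 (g \- horner p)) a b (s' ++ s).
- move=> m mn y yab; rewrite -derive1Sn; apply: dphi => //.
  by rewrite -ltn_predRL.
- by rewrite size_cat szs' /= addnn -mul2n prednK.
- rewrite cat_uniq us' us andbT /=; apply/hasPn => y ys.
  by apply/negP => /s's; rewrite inE ys orbT.
- by move=> y; rewrite mem_cat => /orP[/s'ab|/sab].
- move=> y; rewrite mem_cat => /orP[/d0//|ys].
  have := phiE 1 n20 y (sab _ ys); rewrite derive1n1 => ->.
  rewrite /= -derivE /p derivD derivZ expr2 derivM hornerD hornerZ hornerD.
  by rewrite !hornerM (Hs _ ys).2 Ps// !(mulr0, mul0r) !addr0 mulr0 addr0 subrr.
rewrite -derive1Sn prednK// phiE//= derive1n_horner => /eqP.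
rewrite subr_eq0 => /eqP gy; exists y => //.
(* [H] has degree below [2 * n] and drops out; the monic [P ^+ 2], of degree exactly [2 * n], leaves
   the factorial. *)
suff pn : p^`(2 * n) = (l * (2 * n)`!%:R)%:P.
  rewrite gy pn hornerC mulfK ?pnatr_eq0 -?lt0n ?fact_gt0//.
  by rewrite /l divfK// expf_neq0.
have mP : P ^+ 2 \is monic by rewrite expr2 monicMr monic_prod_XsubC.
have szP : size (P ^+ 2) = (2 * n).+1.
  rewrite expr2 size_monicM ?monic_neq0 ?monic_prod_XsubC//.
  by rewrite size_prod_XsubC addnS /= addSn mul2n addnn.
apply/polyP => i; rewrite coef_derivn coefC coefD coefZ.
rewrite [H`_ _]nth_default ?(leq_trans szH) ?leq_addr// add0r.
case: i => [|i] /=.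
  have := monicP mP; rewrite /lead_coef szP /= => Pn.
  by rewrite addn0 Pn mulr1 ffactnn mulr_natr.
by rewrite [(P ^+ 2)`_ _]nth_default ?mulr0 ?mul0rn// szP addnS ltnS leq_addr.
Qed.

End Rolle_Hermite.

(** * Differentiability of the radial profiles *)

Section n_derivable_theory.
Context {R : realType}.
Implicit Types (f g : R -> R) (a b : R) (n : nat).

Lemma eq_in_derive1n f g a b n : {in `]a, b[, f =1 g} ->
  {in `]a, b[, derive1n n f =1 derive1n n g}.
Proof.
move=> fg; elim: n => [//|n IH] x xab; rewrite /= !derive1E.
apply: near_eq_derive; near=> y; apply: IH; near: y; exact: near_in_itvoo.
Unshelve. all: by end_near. Qed.

Lemma eq_in_n_derivable f g a b n : {in `]a, b[, f =1 g} ->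
  n_derivable n a b f -> n_derivable n a b g.
Proof.
move=> fg df m mn x xab; apply: near_eq_derivable (df m mn x xab).
near=> y; apply: eq_in_derive1n fg _ _; near: y; exact: near_in_itvoo.
Unshelve. all: by end_near. Qed.

(** Lets an induction on the order run on an explicit formula for the first derivative. *)
Lemma n_derivableS f df a b n :
  (forall x, x \in `]a, b[ -> is_derive x 1 f (df x)) ->
  n_derivable n a b df -> n_derivable n.+1 a b f.
Proof.
move=> fdf ndf [_ x /fdf[]//|m mn x xab].
rewrite derive1Sn; apply: eq_in_n_derivable ndf m mn x xab.
by move=> x /fdf[_]; rewrite derive1E => ->.
Qed.

End n_derivable_theory.

(** * Chain rule along rays from the origin *)

Section ray.
Context {R : realType}.
Implicit Types (h : R * R -> R) (x y c s d e r : R).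

(** The increment [d] may have either sign, as the two components of a step along a ray do. *)
Lemma MVT_sym (f df : R -> R) x d :
  (forall z, `|z - x| <= `|d| -> is_derive z 1 f (df z)) ->
  exists2 z, `|z - x| <= `|d| & f (x + d) - f x = df z * d.
Proof.
move=> fdf; have [d0|d0] := leP 0 d.
  have [|z||] := @MVT_segment R f df x (x + d).
  - by rewrite lerDl.
  - rewrite in_itv/= => /andP[xz zd]; apply: fdf.
    rewrite ger0_norm ?subr_ge0 ?(ltW xz)// ger0_norm//.
    by rewrite lerBlDl ltW.
  - apply: derivable_within_continuous => z; rewrite in_itv/= => /andP[xz zd].
    apply: ex_derive; apply: fdf.
    by rewrite ger0_norm ?subr_ge0// ger0_norm// lerBlDl.
  move=> z; rewrite in_itv/= => /andP[xz zd] ->; exists z.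
    by rewrite ger0_norm ?subr_ge0// ger0_norm// lerBlDl.
  by congr (_ * _); ring.
have [|z||] := @MVT_segment R f df (x + d) x.
- by rewrite gerDl ltW.
- rewrite in_itv/= => /andP[xz zd]; apply: fdf.
  rewrite ler0_norm ?subr_le0 ?(ltW zd)// ltr0_norm//; lra.
- apply: derivable_within_continuous => z; rewrite in_itv/= => /andP[xz zd].
  apply: ex_derive; apply: fdf.
  rewrite ler0_norm ?subr_le0// ltr0_norm//; lra.
move=> z; rewrite in_itv/= => /andP[xz zd] E; exists z.
  rewrite ler0_norm ?subr_le0// ltr0_norm//; lra.
by rewrite -opprB E; ring.
Qed.

Lemma is_derive_fst h x y l : is_derive (x, y) ((1, 0) : R * R) h l ->
  is_derive x 1 (fun u => h (u, y)) l.
Proof.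
have E : (fun t => t^-1 *: (h (t *: ((1, 0) : R * R) + (x, y)) - h (x, y))) =
    (fun t : R => t^-1 *: (h (t *: 1 + x, y) - h (x, y))).
  apply/funext => t; congr (_ *: (h _ - _)).
  by apply/pair_equal_spec; split; rewrite //= scaler0 add0r.
move=> [hd hl]; apply: DeriveDef.
  by move: hd; rewrite /derivable E.
by rewrite -hl /derive E.
Qed.

Lemma is_derive_snd h x y l : is_derive (x, y) ((0, 1) : R * R) h l ->
  is_derive y 1 (fun u => h (x, u)) l.
Proof.
have E : (fun t => t^-1 *: (h (t *: ((0, 1) : R * R) + (x, y)) - h (x, y))) =
    (fun t : R => t^-1 *: (h (x, t *: 1 + y) - h (x, y))).
  apply/funext => t; congr (_ *: (h _ - _)).
  by apply/pair_equal_spec; split; rewrite //= scaler0 add0r.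
move=> [hd hl]; apply: DeriveDef.
  by move: hd; rewrite /derivable E.
by rewrite -hl /derive E.
Qed.

(** Only partial derivatives are given, so the step along the ray is split into a horizontal and a
    vertical one. The mean value theorem on each yields values of [hx] and [hy] at points close to
    [p], and continuity finishes. *)
Lemma is_derive_ray (U : set (R * R)) h hx hy c s r : open U ->
  (forall p, U p -> is_derive p ((1, 0) : R * R) h (hx p)) ->
  (forall p, U p -> is_derive p ((0, 1) : R * R) h (hy p)) ->
  {in U, continuous hx} -> {in U, continuous hy} -> U (r * c, r * s) ->
  is_derive r 1 (fun t => h (t * c, t * s))
    (hx (r * c, r * s) * c + hy (r * c, r * s) * s).
Proof.
move=> oU dhx dhy chx chy Up; set p := (r * c, r * s) in Up *.
set L := _ + _.
suff cvgL : t^-1 *: (h ((t *: 1 + r) * c, (t *: 1 + r) * s) - h p) @[t --> 0^'] --> L.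
  by apply: DeriveDef; [apply/cvg_ex; exists L|apply/cvg_lim].
apply/cvgrPdist_le => /= e e0.
(* Errors [e / M] in both partial derivatives, weighted by [c] and [s], add up to at most [e]; the
   summand [1] keeps [M] positive. *)
pose M := `|c| + `|s| + 1.
have M0 : 0 < M by rewrite /M ltr_pwDr// addr_ge0.
have eM0 : 0 < e / M by rewrite divr_gt0.
have /cvgrPdist_le/(_ _ eM0) nx := chx p (mem_set Up).
have /cvgrPdist_le/(_ _ eM0) ny := chy p (mem_set Up).
have nU : nbhs p U by exact: open_nbhs_nbhs.
have [d /= d0 dP] : exists2 d, 0 < d & forall q : R * R,
    `|q.1 - p.1| < d -> `|q.2 - p.2| < d ->
    [/\ U q, `|hx p - hx q| <= e / M & `|hy p - hy q| <= e / M].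
  have : \forall q \near p,
      [/\ U q, `|hx p - hx q| <= e / M & `|hy p - hy q| <= e / M].
    by near=> q; split; near: q.
  move=> /nbhs_ballP[d /= d0 dP]; exists d => // q q1 q2; apply: dP.
  by split; rewrite /ball /= distrC.
near=> t.
have t0 : t != 0 by near: t; exact: nbhs_dnbhs_neq.
have tM : `|t| * M < d.
  rewrite -ltr_pdivlMr//; near: t; apply: dnbhs0_lt; exact: divr_gt0.
have tc : `|t * c| < d.
  rewrite normrM (le_lt_trans _ tM)// ler_wpM2l// /M.
  by have := normr_ge0 s; lra.
have ts : `|t * s| < d.
  rewrite normrM (le_lt_trans _ tM)// ler_wpM2l// /M.
  by have := normr_ge0 c; lra.
have Ud q : `|q.1 - p.1| < d -> `|q.2 - p.2| < d -> U q.
  by move=> q1 q2; have [] := dP q q1 q2.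
(* The horizontal step is taken at the final height [p.2 + t * s], the vertical one at the initial
   abscissa [p.1], so that the two increments telescope. *)
have [u up Eu] : exists2 u, `|u - p.1| <= `|t * c| &
    h (p.1 + t * c, p.2 + t * s) - h (p.1, p.2 + t * s) =
    hx (u, p.2 + t * s) * (t * c).
  apply: (@MVT_sym (fun u => h (u, p.2 + t * s)) (fun u => hx (u, p.2 + t * s))).
  move=> z zc; apply: is_derive_fst; apply: dhx; apply: Ud => /=.
    exact: le_lt_trans zc tc.
  by rewrite addrAC subrr add0r.
have [v vp Ev] : exists2 v, `|v - p.2| <= `|t * s| &
    h (p.1, p.2 + t * s) - h (p.1, p.2) = hy (p.1, v) * (t * s).
  apply: (@MVT_sym (fun v => h (p.1, v)) (fun v => hy (p.1, v))).
  move=> z zc; apply: is_derive_snd; apply: dhy; apply: Ud => /=.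
    by rewrite subrr normr0.
  exact: le_lt_trans zc ts.
have -> : (t *: 1 + r) * c = p.1 + t * c by rewrite [t *: 1]mulr1 /=; ring.
have -> : (t *: 1 + r) * s = p.2 + t * s by rewrite [t *: 1]mulr1 /=; ring.
have -> : h (p.1 + t * c, p.2 + t * s) - h p =
    t * (hx (u, p.2 + t * s) * c + hy (p.1, v) * s).
  rewrite -(subrK (h (p.1, p.2 + t * s)) (h (p.1 + t * c, p.2 + t * s))) Eu -addrA Ev.
  by ring.
rewrite [_ *: _]mulrA mulVf// mul1r /L.
have [_ Hx _] : [/\ U (u, p.2 + t * s), `|hx p - hx (u, p.2 + t * s)| <= e / M
    & `|hy p - hy (u, p.2 + t * s)| <= e / M].
  by apply: dP => /=; [exact: le_lt_trans up tc|rewrite addrAC subrr add0r].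
have [_ _ Hy] : [/\ U (p.1, v), `|hx p - hx (p.1, v)| <= e / M
    & `|hy p - hy (p.1, v)| <= e / M].
  by apply: dP => /=; [rewrite subrr normr0|exact: le_lt_trans vp ts].
rewrite (_ : _ - _ = (hx p - hx (u, p.2 + t * s)) * c + (hy p - hy (p.1, v)) * s);
  last by ring.
rewrite (le_trans (ler_normD _ _))// !normrM.
have -> : e = e / M * `|c| + e / M * `|s| + e / M.
  by rewrite -[LHS](divfK (lt0r_neq0 M0)) {2}/M !mulrDr mulr1.
by rewrite ler_wpDr ?(ltW eM0)// lerD// ler_wpM2r.
Unshelve. all: by end_near. Qed.

End ray.

(** * Differentiation of integrals over circles *)

Section angular.
Context {R : realType}.
Implicit Types (h hx hy : R * R -> R) (k : R -> R) (rad r c x : R) (n : nat).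

Lemma open_disc rad : open (disc rad).
Proof.
rewrite (_ : disc rad =
  (fun p : R * R => p.1 ^+ 2 + p.2 ^+ 2) @^-1` [set x | x < rad ^+ 2])//.
apply: open_comp; last exact: open_lt.
have csq : continuous (fun x : R => x ^+ 2) by exact: exprn_continuous.
move=> p _; apply: cvgD.
  by apply: (continuous_comp _ (csq p.1)); exact: cvg_fst.
by apply: (continuous_comp _ (csq p.2)); exact: cvg_snd.
Qed.

Lemma disc_polar rad r x : 0 <= r < rad -> disc rad (r * cos x, r * sin x).
Proof.
move=> /andP[r0 rrad]; rewrite /disc /= !exprMn -mulrDr cos2Dsin2 mulr1.
by rewrite ltr_pXn2r// nnegrE// (le_trans r0)// ltW.
Qed.

(** The closed disc is compact, being closed inside a square. The bound is uniform up to the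
    boundary and supplies the dominating function for differentiation under the integral. *)
Lemma continuous_closure_disc_bounded rad h : 0 <= rad ->
  {within closure (disc rad), continuous h} ->
  exists2 M : R, 0 <= M & forall p, disc rad p -> `|h p| <= M.
Proof.
move=> rad0 ch.
have cbox : compact (`[- rad, rad] `*` `[- rad, rad] : set (R * R)).
  by apply: compact_setX; exact: segment_compact.
have sub : closure (disc rad) `<=` `[- rad, rad] `*` `[- rad, rad].
  rewrite closureE; apply: smallest_sub.
    by apply: compact_closed cbox; exact: norm_hausdorff.
  have bnd (u v : R) : u ^+ 2 + v ^+ 2 < rad ^+ 2 -> u \in `[- rad, rad].
    move=> uv; rewrite in_itv /= -ler_norml -ler_sqr ?nnegrE// real_normK ?num_real//.
    by rewrite (le_trans _ (ltW uv))// lerDl sqr_ge0.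
  by move=> [u v]; rewrite /disc /= => uv; split => /=; apply: bnd;
    [exact: uv|rewrite addrC; exact: uv].
have cD : compact (closure (disc rad)).
  by apply: subclosed_compact sub => //; exact: closed_closure.
have := compact_bounded (continuous_compact ch cD).
move=> [M [_ MP]]; exists (`|M| + 1); first by rewrite addr_ge0.
move=> p Dp; apply: (MP (`|M| + 1)).
  by rewrite (le_lt_trans (ler_norm _))// ltrDl.
by exists p => //; exact: subset_closure.
Qed.

Lemma Cn_closure_continuous n (U : set (R * R)) h : open U -> Cn_closure n U h ->
  {in U, continuous h}.
Proof.
move=> oU Ch; rewrite -continuous_open_subspace//.
apply: continuous_subspaceW (@subset_closure _ U) _.
by case: n Ch => [|n] [].
Qed.

Lemma Cn_closureW n (U : set (R * R)) h : Cn_closure n.+1 U h -> Cn_closure n U h.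
Proof.
elim: n h => [|n IH] h [ch dh]; first by split.
split=> // e he; have [dhe [g gE Cg]] := dh e he.
by split=> //; exists g => //; exact: IH.
Qed.

Lemma Cn_closure_partials n (U : set (R * R)) h : Cn_closure n.+1 U h ->
  exists hx hy, [/\ Cn_closure n U hx, Cn_closure n U hy,
    forall p, U p -> is_derive p ((1, 0) : R * R) h (hx p) &
    forall p, U p -> is_derive p ((0, 1) : R * R) h (hy p)].
Proof.
move=> [_ Ch].
have [dx [hx hxE Chx]] := Ch (1, 0) (or_introl erefl).
have [dy [hy hyE Chy]] := Ch (0, 1) (or_intror erefl).
exists hx, hy; split=> // p Up.
  by rewrite hxE//; exact/derivableP/dx.
by rewrite hyE//; exact/derivableP/dy.
Qed.

(** A Fourier coefficient with a general kernel [k] in place of [Y k l]: differentiation in [r]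
    multiplies the kernel by [cos] or [sin]. *)
Definition angular_integral h k r : R :=
  \int[lebesgue_measure]_(x in `[0, 2 * pi]) (h (r * cos x, r * sin x) * k x).

Lemma continuous_polar rad h k r : 0 <= r < rad ->
  {in disc rad, continuous h} -> continuous k ->
  continuous (fun x => h (r * cos x, r * sin x) * k x).
Proof.
move=> rrad ch ck x; apply: continuousM; last exact: ck.
have cc : r * cos y @[y --> x] --> r * cos x.
  by apply: cvgM; [exact: cvg_cst|exact: continuous_cos].
have cs : r * sin y @[y --> x] --> r * sin x.
  by apply: cvgM; [exact: cvg_cst|exact: continuous_sin].
apply: (cvg_comp _ _ (cvg_pair cc cs)).
by apply: ch; rewrite inE; exact: disc_polar.
Qed.

Lemma integrable_polar rad h k r : 0 <= r < rad ->
  {in disc rad, continuous h} -> continuous k ->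
  lebesgue_measure.-integrable `[0, 2 * pi]
    (EFin \o (fun x => h (r * cos x, r * sin x) * k x)).
Proof.
move=> rrad ch ck; apply: continuous_compact_integrable.
  exact: segment_compact.
by apply: continuous_subspaceT; exact: (continuous_polar rrad ch ck).
Qed.

(** Differentiation under the integral sign; the integrand is differentiated along each ray by
    [is_derive_ray]. *)
Lemma is_derive_angular_integral rad h hx hy k r : 0 < r < rad ->
  {in disc rad, continuous h} ->
  (forall p, disc rad p -> is_derive p ((1, 0) : R * R) h (hx p)) ->
  (forall p, disc rad p -> is_derive p ((0, 1) : R * R) h (hy p)) ->
  {within closure (disc rad), continuous hx} ->
  {within closure (disc rad), continuous hy} ->
  continuous k ->
  is_derive r 1 (angular_integral h k)
    (angular_integral hx (fun x => cos x * k x) r +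
     angular_integral hy (fun x => sin x * k x) r).
Proof.
move=> /andP[r0 rrad] ch dhx dhy chx chy ck.
have rad0 : 0 < rad by exact: lt_trans rrad.
have [Mx Mx0 hMx] := continuous_closure_disc_bounded (ltW rad0) chx.
have [My My0 hMy] := continuous_closure_disc_bounded (ltW rad0) chy.
have chx' : {in disc rad, continuous hx}.
  by apply: (@Cn_closure_continuous 0); [exact: open_disc|split].
have chy' : {in disc rad, continuous hy}.
  by apply: (@Cn_closure_continuous 0); [exact: open_disc|split].
pose F (r x : R) := h (r * cos x, r * sin x) * k x.
have I0 (s : R) : s \in `]0, rad[ -> 0 <= s < rad.
  by rewrite in_itv /= => /andP[/ltW -> ->].
have dF (s x : R) : s \in `]0, rad[ -> is_derive s 1 (F ^~ x)
    (hx (s * cos x, s * sin x) * (cos x * k x) +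
     hy (s * cos x, s * sin x) * (sin x * k x)).
  move=> /I0 srad; have Ds := disc_polar x srad.
  have := is_derive_ray (@open_disc rad) dhx dhy chx' chy' Ds.
  set d := _ + _ => dh.
  have -> : hx (s * cos x, s * sin x) * (cos x * k x) +
      hy (s * cos x, s * sin x) * (sin x * k x) = k x *: d.
    by rewrite /d [RHS]mulrC mulrDl !mulrA.
  rewrite (_ : F ^~ x = k x \*: (fun t => h (t * cos x, t * sin x))).
    exact: is_deriveZ.
  by apply/funext => t /=; rewrite /F [RHS]mulrC.
have ckcos : continuous (fun x => cos x * k x).
  by move=> x; apply: continuousM; [exact: continuous_cos|exact: ck].
have cksin : continuous (fun x => sin x * k x).
  by move=> x; apply: continuousM; [exact: continuous_sin|exact: ck].
have ra : r \in `]0, rad[ by rewrite in_itv /= r0.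
(* Dominates the derivative of the integrand for all radii in []0, rad[] at once, since [cos] and
   [sin] are bounded by [1]. *)
pose G x := (Mx + My) * `|k x|.
have := @cvg_differentiation_under_integral R _ _ lebesgue_measure F `[0, 2 * pi]
  _ r 0 rad ra _ _ G.
have -> : \int[lebesgue_measure]_(x in `[0, 2 * pi]) partial1of2 F r x =
  angular_integral hx (fun x => cos x * k x) r +
  angular_integral hy (fun x => sin x * k x) r.
  rewrite /angular_integral -RintegralD//=.
  - apply: eq_Rintegral => x _; rewrite partial1of2E.
    by have [_ ->] := dF r x ra.
  - by apply: (@integrable_polar rad) => //; exact: I0.
  - by apply: (@integrable_polar rad) => //; exact: I0.
set L := _ + _ => cvgL.
suff cvgL1 : t^-1 *: (angular_integral h k (t *: 1 + r) -
    angular_integral h k r) @[t --> 0^'] --> L.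
  by apply: DeriveDef; [apply/cvg_ex; exists L|apply/cvg_lim].
rewrite (_ : (fun t : R => _) = (fun t => t^-1 *:
    (angular_integral h k (t + r) - angular_integral h k r))); last first.
  by apply/funext => t; rewrite [t *: 1]mulr1.
apply: cvgL.
- exact: measurable_itv.
- by move=> s /I0 srad; exact: (integrable_polar srad).
- by move=> s x sI _; have [] := dF s x sI.
- by move=> x; rewrite mulr_ge0// addr_ge0.
- apply: continuous_compact_integrable; first exact: segment_compact.
  apply: continuous_subspaceT => x; apply: cvgM; first exact: cvg_cst.
  exact: cvg_norm (ck x).
- move=> s x sI _; rewrite partial1of2E; have [_ ->] := dF s x sI.
  have Ds := disc_polar x (I0 s sI).
  rewrite !mulrA -mulrDl normrM ler_wpM2r// (le_trans (ler_normD _ _))// !normrM.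
  apply: lerD.
    by rewrite -[leRHS]mulr1 ler_pM// ?hMx// ler_norml cos_geN1 cos_le1.
  by rewrite -[leRHS]mulr1 ler_pM// ?hMy// ler_norml sin_geN1 sin_le1.
Qed.

(** With [c] equal to minus half the index and the kernel [Y k l] this is [g_fun]. Exponent and
    kernel are left free so that derivatives are combinations of functions of the same family. *)
Definition radial_profile c h k x : R := x `^ c * angular_integral h k (Num.sqrt x).

Lemma angular_integralZ a h k r rad : 0 <= r < rad ->
  {in disc rad, continuous h} -> continuous k ->
  angular_integral h (fun x => a * k x) r = a * angular_integral h k r.
Proof.
move=> rrad ch ck; rewrite /angular_integral -RintegralZl//.
  by apply: eq_Rintegral => x _; rewrite mulrCA.
exact: (integrable_polar rrad ch ck).
Qed.

Lemma n_derivable_radial_profile n rad c h k : 0 < rad ->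
  Cn_closure n (disc rad) h -> continuous k ->
  n_derivable n 0 (rad ^+ 2) (radial_profile c h k).
Proof.
move=> rad0; elim: n c h k => [//|n IH] c h k Ch ck.
have ch := Cn_closure_continuous (@open_disc rad) Ch.
have [hx [hy [Chx Chy dhx dhy]]] := Cn_closure_partials Ch.
have cnt g : Cn_closure n (disc rad) g -> {within closure (disc rad), continuous g}.
  by case: (n) => [|?] [].
(* The signs make the derivative a difference, as needed for [n_derivableB]. *)
pose kx x := - 2^-1 * (cos x * k x); pose ky x := - 2^-1 * (sin x * k x).
have ckx : continuous (fun x => cos x * k x).
  by move=> x; apply: continuousM; [exact: continuous_cos|exact: ck].
have cky : continuous (fun x => sin x * k x).
  by move=> x; apply: continuousM; [exact: continuous_sin|exact: ck].
have cZ a (g : R -> R) : continuous g -> continuous (fun x => a * g x).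
  by move=> cg x; apply: continuousM; [exact: cvg_cst|exact: cg].
(* The product rule gives one term from the power and two from the angular integral. The inner
   derivative [1 / (2 * sqrt x)] lowers the exponent of the latter by one half and puts the factor
   [2^-1] into [kx] and [ky]. *)
apply: (@n_derivableS _ _ ((radial_profile (c - 1) h (fun x => c * k x) \-
    radial_profile (c - 2^-1) hx kx) \- radial_profile (c - 2^-1) hy ky)); last first.
  apply: (n_derivableB _ _).1; first (apply: (n_derivableB _ _).1).
  - by apply: IH; [exact: Cn_closureW|exact: cZ].
  - by apply: IH => //; exact: cZ.
  - by apply: IH => //; exact: cZ.
move=> x; rewrite in_itv /= => /andP[x0 xrad].
have srad : 0 < Num.sqrt x < rad.
  rewrite sqrtr_gt0 x0 /= -(ger0_norm (ltW rad0)) -sqrtr_sqr.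
  by rewrite ltr_sqrt// exprn_gt0.
have srad' : 0 <= Num.sqrt x < rad.
  by case/andP: srad => /ltW -> ->.
have dA := is_derive_angular_integral srad ch dhx dhy (cnt _ Chx) (cnt _ Chy) ck.
have dp := is_derive1_powR c x0.
have ds := is_derive1_sqrt x0.
have dM := is_deriveM dp (is_derive1_comp dA ds).
apply: (is_derive_eq dM).
rewrite /radial_profile /=.
have chx := Cn_closure_continuous (@open_disc rad) Chx.
have chy := Cn_closure_continuous (@open_disc rad) Chy.
rewrite (angular_integralZ _ srad' ch ck) (angular_integralZ _ srad' chx ckx).
rewrite (angular_integralZ _ srad' chy cky).
rewrite [x `^ (c - 2^-1)]powRB ?(gt_eqF x0) ?implybT// powR12_sqrt ?(ltW x0)//.
rewrite /GRing.scale /=.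
by field; rewrite gt_eqF// sqrtr_gt0.
Qed.

End angular.

(** * Gauss quadrature in one variable *)

Section weighted_moments.
Context {R : realType} {b : R} {v : R -> R}.
Context (mv : measurable_fun `]0, b[ v)
  (v0 : {in `]0, b[, forall x, 0 <= v x}).
Implicit Types (p q : {poly R}) (n : nat).

Local Notation mu := lebesgue_measure.

Definition weighted_moment p : R := \int[mu]_(x in `]0, b[) (p.[x] * v x).

Local Notation L := weighted_moment.

Lemma measurable_horner p (D : set R) : measurable_fun D (horner p).
Proof.
apply: measurable_funTS; apply: continuous_measurable_fun.
exact: continuous_horner.
Qed.

Lemma horner_bounded p :
  [bounded (horner p x : R^o) | x in (`]0, b[ : set R)].
Proof.
have cp : {within (`[0, b] : set R), continuous (horner p)}.
  by apply: continuous_subspaceT; exact: continuous_horner.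
have := compact_bounded (continuous_compact cp (@segment_compact R 0 b)).
move=> [M [Mr MP]]; exists M; split => // x Mx y /= yb.
by apply: (MP _ Mx); exists y => //; exact: subset_itv_oo_cc yb.
Qed.

Lemma integrable_horner_weight p : mu.-integrable `]0, b[ (EFin \o v) ->
  mu.-integrable `]0, b[ (EFin \o (fun x => p.[x] * v x)).
Proof.
move=> iv; rewrite -[_ \o _]/((EFin \o horner p) \* (EFin \o v))%E.
apply: integrableMr => //; last exact: horner_bounded.
exact: measurable_horner.
Qed.

Context (Q : nat -> {poly R}) (hQ : is_orthonormal_polys b v Q).

(* The real-valued integral of [Q 0 ^+ 2 * v] would be [fine +oo = 0] instead of
   [1] if [v] were not integrable. *)
Lemma integrable_weight : mu.-integrable `]0, b[ (EFin \o v).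
Proof.
have [sQ lQ /(_ 0 0)] := hQ.
have /size_poly1P[c c0 ->] : size (Q 0) == 1 by rewrite sQ.
rewrite eqxx => Q00.
have i1 : (\int[mu]_(x in `]0%R, b[) (c%:P.[x] * c%:P.[x] * v x)%R%:E)%E = 1%:E.
  move: Q00; rewrite /Rintegral; set I := integral _ _ _.
  have : (0 <= I)%E.
    apply: integral_ge0 => x xb; rewrite lee_fin mulr_ge0 ?v0//.
    by rewrite !hornerC -expr2 sqr_ge0.
  by case: I => [r _ /= ->|_ /= /eqP|//]; rewrite // eq_sym oner_eq0.
apply/integrableP; split; first exact/measurable_EFinP.
(* [Q 0] is the constant [c], so its norm being [1] forces the integral of [v] to be the inverse of
   [c ^+ 2]. *)
rewrite (_ : (\int[mu]_(x in _) _)%E = ((c ^+ 2)^-1 * 1)%:E) ?ltry//.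
rewrite EFinM -i1 -ge0_integralZl_EFin//=.
- apply: eq_integral => x; rewrite inE => xb; rewrite ger0_norm ?v0//.
  by rewrite -EFinM !hornerC -expr2 mulKf// expf_neq0.
- by move=> x xb; rewrite lee_fin mulr_ge0 ?v0// !hornerC -expr2 sqr_ge0.
- apply/measurable_EFinP; apply: measurable_funM => //.
  by apply: measurable_funM; exact: measurable_horner.
- by rewrite invr_ge0 sqr_ge0.
Qed.

Lemma weighted_momentD p q : L (p + q) = L p + L q.
Proof.
rewrite /L -RintegralD//; try exact: integrable_horner_weight integrable_weight.
by apply: eq_Rintegral => x _; rewrite hornerD mulrDl.
Qed.

Lemma weighted_momentZ c p : L (c *: p) = c * L p.
Proof.
rewrite /L -RintegralZl//; last exact: integrable_horner_weight integrable_weight.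
by apply: eq_Rintegral => x _; rewrite hornerZ mulrA.
Qed.

Lemma weighted_moment0 : L 0 = 0.
Proof. by rewrite -(scale0r 0) weighted_momentZ mul0r. Qed.

(** Induction on a bound [m] for the size of [q]: as [Q m] has degree exactly [m], a multiple of it
    removes the top coefficient, and [Q m] is orthogonal to [Q n] for [m < n]. *)
Lemma orthonormal_low_degree n q : (size q <= n)%N -> L (Q n * q) = 0.
Proof.
have [sQ lQ oQ] := hQ.
suff H m : (m <= n)%N -> forall q, (size q <= m)%N -> L (Q n * q) = 0.
  by move=> /H; exact.
elim: m => [_ {}q|m IH mn {}q sq].
  by rewrite leqn0 size_poly_eq0 => /eqP ->; rewrite mulr0 weighted_moment0.
pose c := q`_m / lead_coef (Q m).
have E : L (Q n * Q m) = 0.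
  transitivity ((n == m)%:R : R); last by rewrite gtn_eqF.
  by rewrite -oQ; apply: eq_Rintegral => x _; rewrite hornerM.
rewrite -(subrK (c *: Q m) q) mulrDr weighted_momentD -scalerAr weighted_momentZ.
rewrite E mulr0 addr0 IH ?(ltnW mn)//.
apply/leq_sizeP => j; rewrite leq_eqVlt => /orP[/eqP <-|mj].
  rewrite coefB coefZ /c.
  have -> : (Q m)`_m = lead_coef (Q m) by rewrite /lead_coef sQ.
  by rewrite divfK ?subrr// gt_eqF.
rewrite coefB coefZ [q`_j]nth_default ?(leq_trans sq)//.
by rewrite nth_default ?sQ// mulr0 subrr.
Qed.

(** Write [Q n = c *: p + q] with [q] of degree below [n]. Then [q] is orthogonal to both [Q n] and
    [p], so the norm [1] of [Q n] equals [c ^+ 2] times that of [p]. *)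
Lemma weighted_moment_sqr n p : p \is monic -> size p = n.+1 ->
  (forall q, (size q <= n)%N -> L (p * q) = 0) ->
  L (p ^+ 2) = (lead_coef (Q n) ^+ 2)^-1.
Proof.
move=> mp sp pq.
have [sQ lQ oQ] := hQ.
set c := lead_coef (Q n); have c0 : c != 0 := lt0r_neq0 (lQ n).
pose q := Q n - c *: p.
have sq : (size q <= n)%N.
  apply/leq_sizeP => j; rewrite leq_eqVlt => /orP[/eqP <-|mj].
    have -> : q`_n = c - c * p`_n by rewrite coefB coefZ /c /lead_coef sQ.
    have := monicP mp; rewrite /lead_coef sp /= => ->.
    by rewrite mulr1 subrr.
  by rewrite coefB coefZ !nth_default ?sp ?sQ// mulr0 subrr.
have QE : Q n = c *: p + q by rewrite addrC subrK.
have L1 : L (Q n * Q n) = 1.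
  transitivity ((n == n)%:R : R); last by rewrite eqxx.
  by rewrite -oQ; apply: eq_Rintegral => x _; rewrite hornerM.
move: L1; rewrite {2}QE mulrDr weighted_momentD [L (_ * q)]orthonormal_low_degree//.
rewrite addr0 -scalerAr weighted_momentZ QE mulrDl weighted_momentD.
rewrite -scalerAl weighted_momentZ [q * p]mulrC (pq q)// addr0 -expr2 mulrA -expr2 => cL.
by apply: (mulfI (expf_neq0 2 c0)); rewrite cL divff// expf_neq0.
Qed.

(** Linearity, starting from the monomials. The quadrature belongs to the signed density [s * v],
    while [L] integrates against [v]. *)
Lemma gauss_quadrature_moment (s : R) n t lam p : s != 0 -> (0 < n)%N ->
  is_gauss_quadrature b (fun x => s * v x) (N := n) t lam ->
  (size p <= 2 * n)%N -> \sum_(j < n) lam j * p.[t j] = s * L p.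
Proof.
move=> s0 n0 [_ _ _ qE] sp.
have -> : p = \sum_(i < 2 * n) p`_i *: 'X^i.
  apply/polyP => i; rewrite -poly_def coef_poly; case: ltnP => // pi.
  by rewrite nth_default// (leq_trans sp).
rewrite (big_morph L weighted_momentD weighted_moment0) mulr_sumr.
transitivity (\sum_(j < n) \sum_(i < 2 * n) p`_i * (lam j * t j ^+ i)).
  apply: eq_bigr => j _; rewrite horner_sum mulr_sumr; apply: eq_bigr => i _.
  by rewrite hornerZ hornerXn mulrCA.
rewrite exchange_big /=; apply: eq_bigr => i _.
rewrite -mulr_sumr weighted_momentZ mulrCA; congr (_ * _).
rewrite qE; last by rewrite -ltnS subn1 prednK ?ltn_ord// muln_gt0.
rewrite /L -RintegralZl//; last exact: integrable_horner_weight integrable_weight.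
by apply: eq_Rintegral => x _; rewrite hornerXn mulrCA.
Qed.

(** The factor [s] carries the constant sign of the density, so that all estimates run against the
    nonnegative [v]. *)
Lemma gauss_quadrature_error (s : R) n t lam (g : R -> R) M :
  `|s| = 1 -> (0 < n)%N ->
  is_gauss_quadrature b (fun x => s * v x) (N := n) t lam ->
  n_derivable (2 * n) 0 b g ->
  {in `]0, b[, forall x, `|derive1n (2 * n) g x| <= M} ->
  `|\int[mu]_(x in `]0, b[) (g x * (s * v x)) - \sum_(j < n) lam j * g (t j)|
    <= ((2 * n)`!%:R * lead_coef (Q n) ^+ 2)^-1 * M.
Proof.
move=> s1 n0 hG dg gM.
have s0 : s != 0 by rewrite -normr_eq0 s1 oner_eq0.
have [tlt tb _ _] := hG.
pose ts := [seq t j | j <- enum 'I_n].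
have szts : size ts = n by rewrite size_map size_enum_ord.
have uts : uniq ts.
  rewrite map_inj_uniq ?enum_uniq// => i j tij.
  by case: (ltngtP i j) => [/tlt|/tlt|/val_inj//]; rewrite tij ltxx.
have tsb : {subset ts <= `]0, b[}.
  by move=> _ /mapP[j _ ->]; rewrite in_itv; exact: tb.
have tts j : t j \in ts by rewrite map_f// mem_enum.
have [H szH Hts] := hermite_interpolation g (derive1 g) uts.
rewrite szts in szH.
have := @hermite_error _ g 0 b ts H; rewrite szts.
move=> /(_ n0 dg uts tsb szH Hts).
set P := \prod_(z <- ts) _ => err.
have Pt j : P.[t j] = 0 by apply/rootP; rewrite root_prod_XsubC.
have LP : L (P ^+ 2) = (lead_coef (Q n) ^+ 2)^-1.
  apply: weighted_moment_sqr.
  - exact: monic_prod_XsubC.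
  - by rewrite size_prod_XsubC szts.
  (* [P * q] has degree at most [2 * n - 1], so the quadrature is exact on it, and it vanishes at
     every node. *)
  - move=> q sq; apply: (mulfI s0); rewrite mulr0.
    rewrite -(gauss_quadrature_moment s0 n0 hG).
      by apply: big1 => j _; rewrite hornerM Pt mul0r mulr0.
    rewrite (leq_trans (size_polyMleq _ _))// size_prod_XsubC szts addSn /=.
    by rewrite mul2n -addnn leq_add2l.
have iH : mu.-integrable `]0, b[ (EFin \o (fun x => H.[x] * (s * v x))).
  have -> : (fun x => H.[x] * (s * v x)) = (fun x => (s *: H).[x] * v x).
    by apply/funext => x; rewrite hornerZ mulrCA mulrA.
  exact: integrable_horner_weight integrable_weight.
pose C := M / (2 * n)`!%:R.
have iP : mu.-integrable `]0, b[ (EFin \o (fun x => C * ((P ^+ 2).[x] * v x))).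
  have -> : (fun x => C * ((P ^+ 2).[x] * v x)) =
      (fun x => (C *: P ^+ 2).[x] * v x).
    by apply/funext => x; rewrite hornerZ mulrA.
  exact: integrable_horner_weight integrable_weight.
(* This pointwise bound serves twice: it makes the remainder integrable by domination, and
   integrating it gives the estimate. *)
have gHM x : x \in `]0, b[ ->
    `|(g x - H.[x]) * (s * v x)| <= C * ((P ^+ 2).[x] * v x).
  move=> xb; have [y yb ->] := err x xb.
  rewrite horner_exp !normrM s1 mul1r (ger0_norm (v0 xb)) [leRHS]mulrA ler_wpM2r ?v0//.
  rewrite -expr2 real_normK ?num_real// /C ler_wpM2r ?sqr_ge0//.
  by rewrite normfV normr_nat ler_wpM2r ?gM// invr_ge0 ler0n.
have mg : measurable_fun (`]0, b[ : set R) g.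
  apply: subspace_continuous_measurable_fun; first exact: measurable_itv.
  apply: derivable_within_continuous => x xb.
  by apply: (dg 0 _ x xb); rewrite muln_gt0.
have igH : mu.-integrable `]0, b[ (EFin \o (fun x => (g x - H.[x]) * (s * v x))).
  apply: le_integrable iP; first exact: measurable_itv.
  - apply/measurable_EFinP; apply: measurable_funM.
      apply: measurable_funB => //; exact: measurable_horner.
    exact: measurable_funM.
  - by move=> x xb; rewrite lee_fin (le_trans (gHM x xb))// ler_norm.
(* The [H] part equals the quadrature sum of [g], because [H] agrees with [g] at the nodes; only the
   remainder is left to estimate. *)
have -> : \int[mu]_(x in `]0, b[) (g x * (s * v x)) =
    \int[mu]_(x in `]0, b[) ((g x - H.[x]) * (s * v x)) + s * L H.
  rewrite -RintegralZl//; last exact: integrable_horner_weight integrable_weight.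
  rewrite -RintegralD//.
    by apply: eq_Rintegral => x _; ring.
  have -> : (fun x => s * (H.[x] * v x)) = (fun x => H.[x] * (s * v x)) => //.
  by apply/funext => x; rewrite mulrCA.
rewrite -(gauss_quadrature_moment s0 n0 hG szH).
have -> : \sum_(j < n) lam j * H.[t j] = \sum_(j < n) lam j * g (t j).
  by apply: eq_bigr => j _; have [->] := Hts _ (tts j).
rewrite addrK (le_trans (le_normr_Rintegral _ igH))//.
have -> : ((2 * n)`!%:R * lead_coef (Q n) ^+ 2)^-1 * M = C * L (P ^+ 2).
  by rewrite LP invfM /C mulrC mulrA.
rewrite -RintegralZl//; last exact: integrable_horner_weight integrable_weight.
apply: le_Rintegral => //.
by move: igH => /integrable_norm.
Qed.

End weighted_moments.

(** * Fourier coefficients *)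

Section fourier_coefficients.
Context {R : realType}.
Implicit Types (rad : R) (f w : R * R -> R) (k l : nat).

Lemma continuous_Y k l : continuous (@Y R k l).
Proof.
have cm : continuous (fun x : R => k%:R * x) by exact: mulrl_continuous.
rewrite /Y => x; case: (k == 0)%N; first exact: cvg_cst.
case: (l == 1)%N; apply: cvgM; try exact: cvg_cst.
  by apply: (continuous_comp (cm x)); exact: continuous_cos.
by apply: (continuous_comp (cm x)); exact: continuous_sin.
Qed.

Lemma n_derivable_g_fun n rad f k l : 0 < rad -> Cn_closure n (disc rad) f ->
  n_derivable n 0 (rad ^+ 2) (g_fun f k l).
Proof.
move=> rad0 Cf.
exact: (n_derivable_radial_profile rad0 Cf (@continuous_Y k l)).
Qed.

Lemma sqrt_in_itvoo rad x : 0 < rad -> x \in `]0, rad ^+ 2[ ->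
  Num.sqrt x \in `]0, rad[.
Proof.
move=> rad0; rewrite !in_itv /= sqrtr_gt0 => /andP[-> xrad] /=.
by rewrite -(ger0_norm (ltW rad0)) -sqrtr_sqr ltr_sqrt// exprn_gt0.
Qed.

Lemma measurable_radial_abs_density rad w k l : 0 < rad ->
  {in `]0, rad[, continuous (fourier w k l)} ->
  measurable_fun (`]0, rad ^+ 2[ : set R) (radial_abs_density w k l).
Proof.
move=> rad0 cw; apply: measurable_funM.
  by apply: measurable_funTS; exact: measurable_powR.
apply: measurableT_comp => //.
apply: open_continuous_measurable_fun; first exact: interval_open.
move=> x; rewrite inE => /(sqrt_in_itvoo rad0) xrad.
by apply: continuous_comp; [exact: sqrt_continuous|exact: cw].
Qed.

Lemma eq_is_gauss_quadrature (b : R) v v' n (t lam : 'I_n -> R) :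
  {in `]0, b[, v =1 v'} ->
  is_gauss_quadrature b v t lam -> is_gauss_quadrature b v' t lam.
Proof.
move=> vv' [tlt tb hlam qE]; split=> // s sn; rewrite qE//.
by apply: eq_Rintegral => x; rewrite inE => xb; rewrite vv'.
Qed.

(** The interval has to be nonempty, since [ereal_sup] of the empty set is [-oo]; its midpoint is
    the witness. *)
Lemma sup_norm_ge0 (b : R) h : 0 < b -> (0 <= sup_norm b h)%E.
Proof.
move=> b0; apply: (@le_trans _ _ (`|h (b / 2)|%:E)); first by rewrite lee_fin.
by apply: ereal_sup_ubound; exists (b / 2) => //=; rewrite in_itv /=; lra.
Qed.

Lemma quadrature_error_le rad w n (t lam : 'I_n -> R) (Q : nat -> {poly R}) f k l :
  0 < rad -> (0 < n)%N ->
  {in `]0, rad[, continuous (fourier w k l)} ->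
  (forall r, 0 < r < rad -> 0 <= fourier w k l r) \/
    (forall r, 0 < r < rad -> fourier w k l r <= 0) ->
  is_gauss_quadrature (rad ^+ 2) (radial_density w k l) t lam ->
  is_orthonormal_polys (rad ^+ 2) (radial_abs_density w k l) Q ->
  Cn_closure (2 * n) (disc rad) f ->
  ((quadrature_error rad f w k l t lam)%:E <=
   (((2 * n)`!%:R * lead_coef (Q n) ^+ 2)^-1)%:E *
   sup_norm (rad ^+ 2) (derive1n (2 * n) (g_fun f k l)))%E.
Proof.
move=> rad0 n0 cw sw hG hQ Cf.
have b0 : 0 < rad ^+ 2 by rewrite exprn_gt0.
(* Pseudo-definiteness enters here: one sign [s] relates the coefficient of [w] to its absolute
   value on the whole interval. *)
have [s s1 sE] : exists2 s : R, `|s| = 1 & forall r, r \in `]0, rad[ ->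
    fourier w k l r = s * `|fourier w k l r|.
  case: sw => sw; [exists 1|exists (-1)]; rewrite ?normrN ?normr1// => r rI;
    have /sw wr : 0 < r < rad by move: rI; rewrite in_itv.
  - by rewrite mul1r ger0_norm.
  - by rewrite mulN1r ler0_norm ?opprK.
have c0 : 0 < ((2 * n)`!%:R * lead_coef (Q n) ^+ 2)^-1.
  have [_ lQ _] := hQ.
  by rewrite invr_gt0 mulr_gt0 ?exprn_gt0// ltr0n fact_gt0.
have dg := @n_derivable_g_fun _ _ f k l rad0 Cf.
set G := derive1n _ _; have := sup_norm_ge0 G b0.
(* If the norm is [+oo] the right side is [+oo], as its constant factor is positive; [-oo] is
   excluded by nonnegativity. *)
case E : (sup_norm (rad ^+ 2) G) => [M| |//] M0; last first.
  by rewrite gt0_muley ?leey ?lte_fin.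
have GM : {in `]0, rad ^+ 2[, forall x, `|G x| <= M}.
  by move=> x xb; rewrite -lee_fin -E; apply: ereal_sup_ubound; exists x.
have hG' : is_gauss_quadrature (rad ^+ 2)
    (fun x => s * radial_abs_density w k l x) t lam.
  apply: eq_is_gauss_quadrature hG => x /(sqrt_in_itvoo rad0) xrad.
  by rewrite /radial_density /radial_abs_density mulrCA -sE.
have v0 : {in `]0, rad ^+ 2[, forall x, 0 <= radial_abs_density w k l x}.
  by move=> x _; rewrite mulr_ge0// powR_ge0.
have mv := measurable_radial_abs_density rad0 cw.
have := gauss_quadrature_error mv v0 hQ s1 n0 hG' dg GM.
rewrite -EFinM lee_fin; congr (`|_ - _| <= _).
  (* The powers of [x] in [g_fun] and in the density cancel, as [x] is positive. *)
  apply: eq_Rintegral => x; rewrite inE => xb.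
  have /andP[x0 _] : 0 < x < rad ^+ 2 by move: xb; rewrite /= in_itv.
  rewrite /g_fun /radial_abs_density powRN [s * _]mulrCA -sE ?sqrt_in_itvoo//.
  by field; rewrite gt_eqF ?powR_gt0.
by apply: eq_bigr => j _; rewrite /g_fun mulrC [_ * fourier _ _ _ _]mulrC.
Qed.

End fourier_coefficients.

(** * Summation of the error bounds over the indices *)

Theorem theorem8 (R : realType) (rad : R) (w : R * R -> R) (N : nat)
    (t lam : nat -> nat -> 'I_N -> R) (Q : nat -> nat -> nat -> {poly R})
    (hrad : 0 < rad) (hN : (1 <= N)%N)
    (hw : is_weight rad w) (hpd : pseudo_definite rad w)
    (hgauss : forall k l, is_index k l -> fourier_neq0 rad w k l ->
       is_gauss_quadrature (rad ^+ 2) (radial_density w k l) (t k l) (lam k l))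
    (hQ : forall k l, is_index k l -> fourier_neq0 rad w k l ->
       is_orthonormal_polys (rad ^+ 2) (radial_abs_density w k l) (Q k l))
    (f : R * R -> R) (hf : Cn_closure (2 * N) (disc rad) f) :
  let kappa k l := lead_coef (Q k l N) in
  let I k l := quadrature_error rad f w k l (t k l) (lam k l) in
  let dg_norm k l :=
    sup_norm (rad ^+ 2) (derive1n (2 * N) (g_fun f k l)) in
  (forall k l, is_index k l -> fourier_neq0 rad w k l ->
     ((I k l)%:E <=
        (((2 * N)`!%:R * kappa k l ^+ 2)^-1)%:E * dg_norm k l)%E) /\
  (forall K : nat,
     `| 2^-1 * (\sum_(0 <= k < K.+1)
                  \sum_(1 <= l < (a k).+1 | `[< fourier_neq0 rad w k l >])
                    radial_integral rad f w k l)
        - 2^-1 * (\sum_(0 <= k < K.+1)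
                  \sum_(1 <= l < (a k).+1 | `[< fourier_neq0 rad w k l >])
                    radial_quadrature f k l (t k l) (lam k l)) |
       <= \sum_(0 <= k < K.+1)
            \sum_(1 <= l < (a k).+1 | `[< fourier_neq0 rad w k l >]) I k l
     /\
     ((\sum_(0 <= k < K.+1)
         \sum_(1 <= l < (a k).+1 | `[< fourier_neq0 rad w k l >]) I k l)%:E <=
        (((2 * N)`!%:R)^-1)%:E *
        \sum_(0 <= k < K.+1)
          \sum_(1 <= l < (a k).+1 | `[< fourier_neq0 rad w k l >])
            ((kappa k l ^+ 2)^-1)%:E * dg_norm k l)%E).
Proof.
move=> kappa I dg_norm.
have b0 : 0 < rad ^+ 2 by rewrite exprn_gt0.
have main k l : is_index k l -> fourier_neq0 rad w k l ->
    ((I k l)%:E <=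
      (((2 * N)`!%:R * kappa k l ^+ 2)^-1)%:E * dg_norm k l)%E.
  move=> kl wkl; have [_ cw _] := hw.
  by apply: quadrature_error_le => //; [exact: cw|exact: hpd|exact: hgauss|exact: hQ].
split=> // K; split.
  rewrite -mulrBr -sumrB.
  under eq_bigr do rewrite -sumrB.
  rewrite normrM ger0_norm ?invr_ge0//.
  (* The factor one half is simply estimated by [1]. *)
  apply: (@le_trans _ _ (1 * `|\sum_(0 <= k < K.+1)
    \sum_(1 <= l < (a k).+1 | `[< fourier_neq0 rad w k l >])
      (radial_integral rad f w k l - radial_quadrature f k l (t k l) (lam k l))|)).
    by rewrite ler_wpM2r// invf_le1// ler1n.
  rewrite mul1r (le_trans (ler_norm_sum _ _ _))// ler_sum// => k _.
  exact: ler_norm_sum.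
(* Some norms may be [+oo]; the constant distributes over the extended sums because all terms are
   nonnegative. *)
rewrite -sumEFin ge0_sume_distrr.
  apply: lee_sum => k _; rewrite -sumEFin ge0_sume_distrr.
    (* The range of [l] must be kept as a condition, since it is what yields [is_index k l]. *)
    rewrite big_seq_cond [leRHS]big_seq_cond; apply: lee_sum => l.
    rewrite mem_index_iota ltnS => /andP[kl /asboolP wkl].
    by rewrite muleA -EFinM -invfM; exact: main.
  by move=> l _; rewrite mule_ge0 ?sup_norm_ge0// lee_fin invr_ge0 sqr_ge0.
move=> k _; apply: sume_ge0 => l _.
by rewrite mule_ge0 ?sup_norm_ge0// lee_fin invr_ge0 sqr_ge0.
Qed.
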